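(* Let $\Omega=\{(x,y)\in\mathbb{R}^2 : x>0,\ y<0\}$ be the fourth quadrant and let $\varphi:\Omega\to\mathbb{R}^2_+$ be the map $$\varphi(x,y)=\left(\frac{e^{x}\sqrt{1-e^{y}}}{e^{x}-e^{y}},\ \frac{e^{y}\sqrt{e^{x}-1}}{e^{x}-e^{y}}\right).$$ Then $\varphi$ is surjective, and it maps the rays $x=\mathrm{const}$ in $\Omega$ to arcs of circles of the elliptic Apollonian pencil of $F_1,F_2$, the rays $y=\mathrm{const}$ in $\Omega$ to arcs of circles of the hyperbolic Apollonian pencil of $F_1,F_2$, and the intervals $x-y=\mathrm{const}$ in $\Omega$ to arcs of ellipses with foci $F_1$ and $F_2$.
   Context: $\mathbb{R}^2_+=\{(s,t)\in\mathbb{R}^2: s>0,\ t>0\}$ is the (open) positive quadrant. The foci are $F_1=(-1,0)$ and $F_2=(1,0)$. The elliptic Apollonian pencil of $F_1,F_2$ is the family of circles passing through both $F_1$ and $F_2$. The hyperbolic Apollonian pencil of $F_1,F_2$ is the family of circles orthogonal to all circles of the elliptic pencil; each of its circles is a locus of points $X$ with $|XF_1|/|XF_2|=\mathrm{const}$. An ellipse with foci $F_1,F_2$ is a locus $|XF_1|+|XF_2|=\mathrm{const}$ with constant greater than $2$. *)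

(* Defs.v *)
From HB Require Import structures.
From mathcomp Require Import all_boot all_order all_algebra.
From mathcomp Require Import all_classical all_reals all_analysis.

Set Implicit Arguments.
Unset Strict Implicit.
Unset Printing Implicit Defensive.

Import Order.TTheory GRing.Theory Num.Theory.
Import numFieldNormedType.Exports.

Local Open Scope classical_set_scope.
Local Open Scope ring_scope.

Section Plane.
Variable R : realType.

(* The canonical norm on [R * R] is the sup norm, so the Euclidean structure
   of the plane is spelled out here. *)
Definition dotp (u v : R * R) : R := u.1 * v.1 + u.2 * v.2.

Definition edist (X Y : R * R) : R := Num.sqrt (dotp (X - Y) (X - Y)).

Definition F1 : R * R := (-1, 0).
Definition F2 : R * R := (1, 0).

Record circle := Circle {
  center : R * R;
  radius : R;
  radius_gt0 : 0 < radius }.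

Definition circle_set (K : circle) : set (R * R) :=
  [set X | edist X (center K) = radius K].

(* For X on K: the tangent line at X is the one perpendicular to the radius. *)
Definition tangent_at (K : circle) (X : R * R) : set (R * R) :=
  [set v | dotp v (X - center K) = 0].

Definition orthogonal_circles (K L : circle) : Prop :=
  (circle_set K `&` circle_set L !=set0) /\
  (forall X, circle_set K X -> circle_set L X ->
     forall u v, tangent_at K X u -> tangent_at L X v -> dotp u v = 0).

Definition elliptic_pencil : set circle :=
  [set K | circle_set K F1 /\ circle_set K F2].

Definition hyperbolic_pencil : set circle :=
  [set K | forall L, elliptic_pencil L -> orthogonal_circles K L].

Definition ellipse (d : R) : set (R * R) :=
  [set X | edist X F1 + edist X F2 = d].

(* On a simple closed curve C (a circle or an ellipse), the arcs, with or
   without their endpoints, are the connected proper subsets of C that have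
   at least two points. *)
Definition arc_of (C A : set (R * R)) : Prop :=
  [/\ A `<` C, connected A & exists X Y, [/\ A X, A Y & X != Y]].

Definition quadrant1 : set (R * R) := [set p | 0 < p.1 /\ 0 < p.2].

Definition Omega : set (R * R) := [set p | 0 < p.1 /\ p.2 < 0].

Definition phi (p : R * R) : R * R :=
  let: (x, y) := p in
  (expR x * Num.sqrt (1 - expR y) / (expR x - expR y),
   expR y * Num.sqrt (expR x - 1) / (expR x - expR y)).

End Plane.

Arguments F1 {R}.
Arguments F2 {R}.
Arguments elliptic_pencil {R}.
Arguments hyperbolic_pencil {R}.
Arguments quadrant1 {R}.
Arguments Omega {R}.

(* Main.v *)
Require Import Defs.
From mathcomp Require Import all_boot all_order all_algebra.
From mathcomp Require Import all_classical all_reals all_analysis.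
From mathcomp Require Import ring lra.

(** Put [p = sqrt (e^x - 1)] and [q = sqrt (1 - e^y)].  Then [phi (x, y)] is
    the rational point [bipolar p q] with coordinates
    [(1 + p^2) q / (p^2 + q^2)] and [(1 - q^2) p / (p^2 + q^2)], and all the
    geometry becomes algebra in [p > 0] and [0 < q < 1].  Eliminating one of
    the two parameters from a point [(s, t)] gives
    [(s^2 + t^2 - 1) p = (1 - p^2) t] and [(s^2 + t^2 + 1) q = (1 + q^2) s].
    For fixed [p], that is fixed [x], the first equation is the circle through
    both foci with center [(0, (1 - p^2) / 2p)] ([bipolar_elliptic]); for
    fixed [q], that is fixed [y], the second one is the circle with center
    [((1 + q^2) / 2q, 0)] and squared radius [h^2 - 1], where [h] is the
    abscissa of its center ([bipolar_quad]).  Such a circle is orthogonal to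
    every circle through the foci ([hyperbolic_pencil_suff]).  Moreover the
    distances from [bipolar p q] to the foci are [(d / 2) (1 + q)] and
    [(d / 2) (1 - q)] with [d^2 = 4 (1 + p^2) / (p^2 + q^2)], so that their
    sum [d] depends only on [e^(y - x) = (1 - q^2) / (1 + p^2)]
    ([ellipse_bipolar]).

    For [(s, t)] in the open first quadrant, the equation for [q] is quadratic
    with roots of product 1, so exactly one root lies in [(0, 1)]; then [p] is
    given by the linear relation [s q + t p = 1].  Hence [bipolar] is a
    bijection onto the quadrant ([bipolar_surj], [bipolar_inj]), and so is
    [phi].  The images of the three kinds of lines are arcs
    ([arc_of_phi_path]): they are connected because [phi] is continuous,
    have more than one point because [phi] is injective, and are proper parts
    of their curves because these curves leave the first quadrant. *)

Import Order.TTheory GRing.Theory Num.Theory.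
Import numFieldNormedType.Exports.

Local Open Scope classical_set_scope.
Local Open Scope ring_scope.

(** * Distances and the elliptic pencil in coordinates *)

Lemma edist_eq (R : realType) (X Y : R * R) (r : R) : 0 <= r ->
  Defs.edist X Y = r <-> (X.1 - Y.1) ^+ 2 + (X.2 - Y.2) ^+ 2 = r ^+ 2.
Proof.
move=> r0; rewrite /Defs.edist /dotp /= -!expr2; split=> [<-|->].
  by rewrite sqr_sqrtr // addr_ge0 ?sqr_ge0.
by rewrite sqrtr_sqr ger0_norm.
Qed.

Lemma circle_setE (R : realType) (K : circle R) (X : R * R) :
  circle_set K X <->
  (X.1 - (Defs.center K).1) ^+ 2 + (X.2 - (Defs.center K).2) ^+ 2 =
    Defs.radius K ^+ 2.
Proof. by apply: edist_eq; apply/ltW/Defs.radius_gt0. Qed.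

Lemma elliptic_pencilE (R : realType) (K : circle R) :
  elliptic_pencil K <->
  (Defs.center K).1 = 0 /\ Defs.radius K ^+ 2 = 1 + (Defs.center K).2 ^+ 2.
Proof.
rewrite /elliptic_pencil /= !circle_setE /=; split=> [[e1 e2]|[-> ->]].
  have h : (Defs.center K).1 = 0 by lra.
  by split=> //; rewrite -e1 h; ring.
by split; ring.
Qed.

(** * Rational coordinates on the first quadrant *)

(** As a complex number this is [(1 - i p q) / (q - i p)]. *)
Definition bipolar {R : realType} (p q : R) : R * R :=
  ((1 + p ^+ 2) * q / (p ^+ 2 + q ^+ 2), (1 - q ^+ 2) * p / (p ^+ 2 + q ^+ 2)).

(** The real and imaginary parts of [w (q - i p) = 1 - i p q]; being linear
    in the coordinates of [w], they characterize the point ([bipolarP]). *)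
Lemma bipolar_sys (R : realType) (p q : R) : 0 < p -> 0 < q ->
  (bipolar p q).1 * q + (bipolar p q).2 * p = 1 /\
  (bipolar p q).1 * p - (bipolar p q).2 * q = p * q.
Proof.
move=> p0 q0; have D0 : p ^+ 2 + q ^+ 2 != 0 by apply: lt0r_neq0; nra.
by split; rewrite /=; field.
Qed.

Lemma bipolarP (R : realType) (p q s t : R) : 0 < p -> 0 < q ->
  s * q + t * p = 1 -> s * p - t * q = p * q -> bipolar p q = (s, t).
Proof.
move=> p0 q0 e1 e2.
have D0 : p ^+ 2 + q ^+ 2 != 0 by apply: lt0r_neq0; nra.
rewrite /bipolar; congr pair; apply: (mulIf D0); rewrite divfK //.
  have -> : s * (p ^+ 2 + q ^+ 2) = (s * q + t * p) * q + (s * p - t * q) * p.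
    by ring.
  by rewrite e1 e2; ring.
have -> : t * (p ^+ 2 + q ^+ 2) = (s * q + t * p) * p - (s * p - t * q) * q.
  by ring.
by rewrite e1 e2; ring.
Qed.

(** Eliminating [p]: substitute [w.2 * p = 1 - w.1 * q] from the first equation
    of [bipolar_sys] into a combination of both. *)
Lemma bipolar_quad (R : realType) (p q : R) : 0 < p -> 0 < q ->
  (bipolar p q).1 * (1 + q ^+ 2) =
  ((bipolar p q).1 ^+ 2 + (bipolar p q).2 ^+ 2 + 1) * q.
Proof.
move=> p0 q0; have [] := bipolar_sys _ _ _ p0 q0.
move: (bipolar p q) => w e1 e2.
have -> : (w.1 ^+ 2 + w.2 ^+ 2 + 1) * q =
  w.1 * (w.1 * q + w.2 * p) - w.2 * (w.1 * p - w.2 * q) + q by ring.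
have e2' : w.2 * (w.1 * p - w.2 * q) = w.2 * p * q by rewrite e2 mulrA.
have e3 : w.2 * p = 1 - w.1 * q by lra.
by rewrite e2' e1 e3; ring.
Qed.

Lemma bipolar_quadrant1 (R : realType) (p q : R) : 0 < p -> 0 < q < 1 ->
  quadrant1 (bipolar p q).
Proof.
move=> p0 /andP[q0 q1]; split=> /=; apply: divr_gt0; rewrite ?mulr_gt0 //; nra.
Qed.

(** By [bipolar_quad], [q] and [q'] solve the same quadratic equation, whose
    roots have product 1; as both are less than 1 they coincide. *)
Lemma bipolar_inj (R : realType) (p q p' q' : R) :
  0 < p -> 0 < q < 1 -> 0 < p' -> 0 < q' < 1 ->
  bipolar p q = bipolar p' q' -> p = p' /\ q = q'.
Proof.
move=> p0 Hq p0' Hq' e; have [s0 t0] := bipolar_quadrant1 _ _ _ p0 Hq.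
case/andP: Hq => q0 q1; case/andP: Hq' => q0' q1'.
have := bipolar_quad _ _ _ p0 q0; have := bipolar_quad _ _ _ p0' q0'.
have [e1 _] := bipolar_sys _ _ _ p0 q0.
have [e1' _] := bipolar_sys _ _ _ p0' q0'.
rewrite -e in e1' *; move: s0 t0 e1 e1'.
set s := (bipolar p q).1; set t := (bipolar p q).2 => s0 t0 e1 e1' Q' Q.
clearbody s t.
have qq : q = q'.
  have : s * ((1 - q * q') * (q - q')) = 0.
    have -> : s * ((1 - q * q') * (q - q')) =
       q * (s * (1 + q' ^+ 2)) - q' * (s * (1 + q ^+ 2)) by ring.
    by rewrite Q Q'; ring.
  move/eqP; rewrite !mulf_eq0 (gt_eqF s0) /= => /orP[/eqP|/eqP]; last by lra.
  by nra.
split=> //; apply: (mulfI (lt0r_neq0 t0)); rewrite qq in e1; lra.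
Qed.

(** The smaller root [q] of [s q^2 - m q + s] with [m = s^2 + t^2 + 1] works:
    the polynomial is positive at 0 and negative at 1 and at [1 / s], whence
    [q < 1] and [s q < 1]; the latter makes [p = (1 - s q) / t] positive. *)
Lemma bipolar_surj (R : realType) (s t : R) : 0 < s -> 0 < t ->
  exists p q : R, [/\ 0 < p, 0 < q < 1 & bipolar p q = (s, t)].
Proof.
move=> s0 t0.
pose m := s ^+ 2 + t ^+ 2 + 1.
have m0 : 0 < m by rewrite /m; nra.
pose D := Num.sqrt (m ^+ 2 - 4 * s ^+ 2).
have D2 : D ^+ 2 = m ^+ 2 - 4 * s ^+ 2.
  rewrite sqr_sqrtr // subr_ge0.
  have := sqr_ge0 (s - 1); rewrite /m => s1.
  have -> : 4 * s ^+ 2 = (2 * s) ^+ 2 by ring.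
  by rewrite ler_sqr ?nnegrE; nra.
have D0 : 0 <= D by exact: sqrtr_ge0.
pose q := (m - D) / (2 * s).
have qD : 2 * s * q = m - D by rewrite /q mulrC divfK // lt0r_neq0 //; lra.
have Q : s * q ^+ 2 + s = m * q.
  have s4 : 4 * s != 0 by apply: lt0r_neq0; lra.
  apply: (mulfI s4).
  have -> : 4 * s * (s * q ^+ 2 + s) = (2 * s * q) ^+ 2 + 4 * s ^+ 2 by ring.
  have -> : 4 * s * (m * q) = 2 * m * (2 * s * q) by ring.
  by rewrite qD; lra.
have q0 : 0 < q by rewrite -(pmulr_rgt0 _ m0) -Q; nra.
have mD : 2 * s * q <= m by lra.
have q1 : q < 1.
  have q_le1 : q <= 1.
    rewrite leNgt; apply/negP => q1.
    have : 2 * s * q * q <= m * q by rewrite ler_pM2r.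
    have : 0 < s * ((q - 1) * (q + 1)) by rewrite !mulr_gt0 //; lra.
    by lra.
  rewrite lt_neqAle q_le1 andbT; apply/eqP => q1.
  move: Q; rewrite q1 /m => Q.
  have := sqr_ge0 (s - 1); have : 0 < t ^+ 2 by rewrite exprn_gt0.
  by lra.
have sq1 : s * q < 1.
  rewrite ltNge; apply/negP => sq1.
  (* [s (s q^2 - m q + s) = (s q - 1) (s q - s^2) - t^2 s q]. *)
  have us : s * q < s by rewrite gtr_pMr.
  have : 0 <= (s * q - 1) * (s ^+ 2 - s * q).
    have : s <= s ^+ 2 by rewrite expr2 ler_peMr; lra.
    by move=> ?; rewrite mulr_ge0 //; lra.
  have : s * (s * q ^+ 2 + s) = s * (m * q) by rewrite Q.
  have : 0 < t ^+ 2 * (s * q) by apply: mulr_gt0; [exact: exprn_gt0|lra].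
  by rewrite /m; lra.
exists ((1 - s * q) / t), q; split.
- by apply: divr_gt0 => //; lra.
- by rewrite q0.
- apply: bipolarP => //; first by apply: divr_gt0 => //; lra.
    by rewrite mulrC; field; rewrite lt0r_neq0.
  have t1 : t != 0 by rewrite lt0r_neq0.
  apply: (mulIf t1).
  have -> : (s * ((1 - s * q) / t) - t * q) * t =
     s * (1 - s * q) - t ^+ 2 * q by field.
  have -> : (1 - s * q) / t * q * t = (1 - s * q) * q by field.
  by rewrite /m in Q; lra.
Qed.

(** * The map phi in these coordinates *)

Lemma phi_bipolar (R : realType) (p q : R) : 0 < p -> 0 < q < 1 ->
  phi (ln (1 + p ^+ 2), ln (1 - q ^+ 2)) = bipolar p q.
Proof.
move=> p0 /andP[q0 q1]; rewrite /phi /bipolar !lnK ?posrE; [|nra..].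
have -> : 1 - (1 - q ^+ 2) = q ^+ 2 by ring.
have -> : 1 + p ^+ 2 - 1 = p ^+ 2 by ring.
rewrite !sqrtr_sqr !gtr0_norm //.
by have -> : 1 + p ^+ 2 - (1 - q ^+ 2) = p ^+ 2 + q ^+ 2 by ring.
Qed.

Lemma gt0_lnP (R : realType) (x : R) :
  0 < x -> exists2 p : R, 0 < p & x = ln (1 + p ^+ 2).
Proof.
rewrite -expR_gt1 => a1; exists (Num.sqrt (expR x - 1)).
  by rewrite sqrtr_gt0; lra.
by rewrite sqr_sqrtr ?subrKC ?expRK //; lra.
Qed.

Lemma lt0_lnP (R : realType) (y : R) :
  y < 0 -> exists2 q : R, 0 < q < 1 & y = ln (1 - q ^+ 2).
Proof.
rewrite -expR_lt1 => b1; have b0 := expR_gt0 y.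
exists (Num.sqrt (1 - expR y)).
  rewrite sqrtr_gt0; apply/andP; split; first by lra.
  by rewrite -[ltRHS]sqrtr1 ltr_sqrt //; lra.
by rewrite sqr_sqrtr ?subKr ?expRK //; lra.
Qed.

Lemma OmegaP (R : realType) (z : R * R) : Omega z <->
  exists p q : R,
    [/\ 0 < p, 0 < q < 1 & z = (ln (1 + p ^+ 2), ln (1 - q ^+ 2))].
Proof.
case: z => x y; split=> [[/= x0 y0]|[p [q [p0 /andP[q0 q1] [-> ->]]]]].
  have [p p0 ->] := gt0_lnP _ _ x0; have [q q01 ->] := lt0_lnP _ _ y0.
  by exists p, q.
by split=> /=; [rewrite ln_gt0|rewrite ln_lt0 //; apply/andP; split]; nra.
Qed.

Lemma phi_quadrant1 (R : realType) : set_fun Omega quadrant1 (@phi R).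
Proof.
move=> z /OmegaP[p [q [p0 q01 ->]]]; rewrite phi_bipolar //.
exact: bipolar_quadrant1.
Qed.

Lemma phi_inj (R : realType) (z w : R * R) :
  Omega z -> Omega w -> phi z = phi w -> z = w.
Proof.
move=> /OmegaP[p [q [p0 q01 ->]]] /OmegaP[p' [q' [p0' q01' ->]]].
by rewrite !phi_bipolar // => /bipolar_inj[] // -> ->.
Qed.

Lemma phi_continuous (R : realType) (z : R * R) :
  Omega z -> {for z, continuous (@phi R)}.
Proof.
case: z => x y [/= x0 y0].
have ex : (fun w : R * R => expR w.1) @ (x, y) --> expR x.
  by apply: continuous_cvg; [exact: continuous_expR|exact: cvg_fst].
have ey : (fun w : R * R => expR w.2) @ (x, y) --> expR y.
  by apply: continuous_cvg; [exact: continuous_expR|exact: cvg_snd].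
have dn0 : expR x - expR y != 0.
  by rewrite subr_eq0 gt_eqF // ltr_expR; lra.
have -> : @phi R = (fun w =>
  (expR w.1 * Num.sqrt (1 - expR w.2) / (expR w.1 - expR w.2),
   expR w.2 * Num.sqrt (expR w.1 - 1) / (expR w.1 - expR w.2))).
  by apply/funext => -[].
have c1 : expR w.1 * Num.sqrt (1 - expR w.2) / (expR w.1 - expR w.2)
    @[w --> (x, y)] --> expR x * Num.sqrt (1 - expR y) / (expR x - expR y).
  apply: cvgM; last by apply: cvgV => //; exact: cvgB.
  apply: cvgM => //; apply: continuous_cvg; first exact: sqrt_continuous.
  by apply: cvgB => //; exact: cvg_cst.
have c2 : expR w.2 * Num.sqrt (expR w.1 - 1) / (expR w.1 - expR w.2)
    @[w --> (x, y)] --> expR y * Num.sqrt (expR x - 1) / (expR x - expR y).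
  apply: cvgM; last by apply: cvgV => //; exact: cvgB.
  apply: cvgM => //; apply: continuous_cvg; first exact: sqrt_continuous.
  by apply: cvgB => //; exact: cvg_cst.
exact: cvg_pair c1 c2.
Qed.

(** Every image considered here stays in the open first quadrant, so one point
    [X] of the curve outside it shows that the image is a proper part. *)
Lemma arc_of_phi_path (R : realType) (C : set (R * R)) (J : set R)
    (g : R -> R * R) :
  is_interval J -> continuous g -> injective g -> g @` J `<=` Omega ->
  (exists u v, [/\ J u, J v & u != v]) ->
  (forall u, J u -> C (phi (g u))) -> (exists2 X, C X & ~ quadrant1 X) ->
  arc_of C (@phi R @` (g @` J)).
Proof.
move=> Ji gc gi gO [u [v [Ju Jv uv]]] AC [X CX nX].
split.
- split; first by move=> _ [_ [w Jw <-] <-]; exact: AC.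
  move=> /(_ _ CX)[z zJ zX]; apply: nX; rewrite -zX.
  by apply: phi_quadrant1; exact: gO.
- rewrite image_comp; apply: connected_continuous_connected.
    exact/connected_intervalP.
  apply: continuous_in_subspaceT => w; rewrite inE => Jw.
  apply: continuous_comp; first exact: gc.
  by apply: phi_continuous; apply: gO; exists w.
- exists (phi (g u)), (phi (g v)); split.
    by exists (g u) => //; exists u.
    by exists (g v) => //; exists v.
  apply: contra_neq uv => /phi_inj e; apply: gi; apply: e.
    by apply: gO; exists u.
  by apply: gO; exists v.
Qed.

(** * Membership in the circles of the two pencils *)

(** Eliminating [q] from [bipolar_sys], as in [bipolar_quad]. *)
Lemma bipolar_elliptic (R : realType) (p q : R) : 0 < p -> 0 < q ->
  ((bipolar p q).1 ^+ 2 + (bipolar p q).2 ^+ 2 - 1) * p =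
  (1 - p ^+ 2) * (bipolar p q).2.
Proof.
move=> p0 q0; have [] := bipolar_sys _ _ _ p0 q0.
move: (bipolar p q) => w e1 e2.
have -> : (w.1 ^+ 2 + w.2 ^+ 2 - 1) * p =
  w.1 * (w.1 * p - w.2 * q) + w.2 * (w.1 * q + w.2 * p) - p by ring.
have e1' : w.1 * q = 1 - w.2 * p by lra.
have e2' : w.1 * (w.1 * p - w.2 * q) = w.1 * q * p by rewrite e2; ring.
by rewrite e2' e1 e1'; ring.
Qed.

Lemma elliptic_circle_mem (R : realType) (K : circle R) (p q : R) :
  elliptic_pencil K -> 0 < p -> 0 < q ->
  2 * (Defs.center K).2 * p = 1 - p ^+ 2 -> circle_set K (bipolar p q).
Proof.
move=> /elliptic_pencilE[k1 r2] p0 q0 kp; apply/circle_setE.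
rewrite k1 r2; have := bipolar_elliptic _ _ _ p0 q0; rewrite -kp.
move: (bipolar p q) => w e.
have : p * (w.1 ^+ 2 + w.2 ^+ 2 - 1 - 2 * (Defs.center K).2 * w.2) = 0 by lra.
by move/eqP; rewrite mulf_eq0 (gt_eqF p0) /= => /eqP; lra.
Qed.

Lemma hyperbolic_circle_mem (R : realType) (K : circle R) (p q : R) :
  (Defs.center K).2 = 0 -> Defs.radius K ^+ 2 = (Defs.center K).1 ^+ 2 - 1 ->
  0 < p -> 0 < q -> 2 * (Defs.center K).1 * q = 1 + q ^+ 2 ->
  circle_set K (bipolar p q).
Proof.
move=> k2 r2 p0 q0 kq; apply/circle_setE.
rewrite k2 r2; have := bipolar_quad _ _ _ p0 q0; rewrite -kq.
move: (bipolar p q) => w e.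
have : q * (w.1 ^+ 2 + w.2 ^+ 2 + 1 - 2 * (Defs.center K).1 * w.1) = 0 by lra.
by move/eqP; rewrite mulf_eq0 (gt_eqF q0) /= => /eqP; lra.
Qed.

(** In the plane [u] is a multiple of [m] turned by a right angle, and likewise
    [v] of [n], so [u] and [v] enclose the same angle as [m] and [n]. *)
Lemma dotp_perp (R : realType) (m n u v : R * R) :
  dotp m m != 0 -> dotp n n != 0 -> dotp m n = 0 ->
  dotp u m = 0 -> dotp v n = 0 -> dotp u v = 0.
Proof.
rewrite /dotp => m0 n0 mn um vn; apply: (mulfI m0); apply: (mulfI n0).
rewrite !mulr0.
(* Multiplied by [|m|^2 |n|^2], the claim is the expansion of [u] and [v] in
   the orthogonal frames [m, m^perp] and [n, n^perp]: [U], [V] are the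
   coordinates along [m], [n], and [a], [b] those along the perpendiculars. *)
set a := u.2 * m.1 - u.1 * m.2; set b := v.2 * n.1 - v.1 * n.2.
pose U := u.1 * m.1 + u.2 * m.2; pose V := v.1 * n.1 + v.2 * n.2.
pose M := m.1 * n.1 + m.2 * n.2; pose N := m.1 * n.2 - m.2 * n.1.
have -> : (n.1 * n.1 + n.2 * n.2) * ((m.1 * m.1 + m.2 * m.2) *
  (u.1 * v.1 + u.2 * v.2)) = (U * V + a * b) * M + (a * V - U * b) * N.
  by rewrite /a /b /U /V /M /N; ring.
by rewrite /U /V /M um vn mn; ring.
Qed.

(** Let [L] be centered at [(0, k)].  The circles meet in [bipolar p q], where
    [p], [q] are the parameters attached to the two centers.  At a common
    point, the scalar product of the two radius vectors is half the sum of
    [X.1^2 + X.2^2 - 2 h X.1 + 1] and [X.1^2 + X.2^2 - 2 k X.2 - 1], the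
    polynomials vanishing on [K] and on [L]: it is zero. *)
Lemma hyperbolic_pencil_suff (R : realType) (K : circle R) :
  (Defs.center K).2 = 0 -> 0 < (Defs.center K).1 ->
  Defs.radius K ^+ 2 = (Defs.center K).1 ^+ 2 - 1 -> hyperbolic_pencil K.
Proof.
move=> k2 k0 r2 L EL; have /elliptic_pencilE[l1 s2] := EL; split.
  pose h := (Defs.center K).1; pose k := (Defs.center L).2.
  have r0 := Defs.radius_gt0 K.
  (* The positive root of [p^2 + 2 k p - 1] and, below, the smaller root of
     [q^2 - 2 h q + 1]. *)
  pose p := Num.sqrt (1 + k ^+ 2) - k.
  have S2 : Num.sqrt (1 + k ^+ 2) ^+ 2 = 1 + k ^+ 2.
    by rewrite sqr_sqrtr // addr_ge0 ?sqr_ge0.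
  have p0 : 0 < p.
    rewrite /p subr_gt0; apply: le_lt_trans (ler_norm k) _.
    by rewrite -sqrtr_sqr ltr_sqrt; nra.
  pose q := h - Defs.radius K.
  have q0 : 0 < q.
    have : 0 < (h - Defs.radius K) * (h + Defs.radius K) by rewrite /h; lra.
    by rewrite pmulr_lgt0 //; rewrite /h; lra.
  exists (bipolar p q); split.
    by apply: hyperbolic_circle_mem => //; rewrite /q -/h; lra.
  by apply: elliptic_circle_mem => //; rewrite -/k /p; lra.
move=> X /circle_setE XK /circle_setE XL u v.
apply: dotp_perp => /=.
- by rewrite /dotp /= -!expr2 XK expf_neq0 // gt_eqF // Defs.radius_gt0.
- by rewrite /dotp /= -!expr2 XL expf_neq0 // gt_eqF // Defs.radius_gt0.
- by move: XK XL; rewrite /dotp /= k2 l1 r2 s2; lra.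
Qed.

(** * Focal distances *)

(** For [e = 1] and [e = -1] this is the squared distance to a focus, and the
    right-hand side is the perfect square
    [(1 + p^2) / (p^2 + q^2) * (1 + e q)^2]. *)
Lemma bipolar_focal (R : realType) (p q e : R) : 0 < p -> 0 < q ->
  ((bipolar p q).1 + e) ^+ 2 + (bipolar p q).2 ^+ 2 =
  ((1 + p ^+ 2) / (p ^+ 2 + q ^+ 2)) * (1 + q ^+ 2 + 2 * e * q) + e ^+ 2 - 1.
Proof.
move=> p0 q0; have D0 : p ^+ 2 + q ^+ 2 != 0 by apply: lt0r_neq0; nra.
by rewrite /=; field.
Qed.

Lemma ellipse_bipolar (R : realType) (p q d : R) : 0 < p -> 0 < q < 1 ->
  0 < d -> d ^+ 2 = 4 * (1 + p ^+ 2) / (p ^+ 2 + q ^+ 2) ->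
  ellipse d (bipolar p q).
Proof.
move=> p0 /andP[q0 q1] d0 d2.
have d4 : (1 + p ^+ 2) / (p ^+ 2 + q ^+ 2) = (d / 2) ^+ 2.
  by rewrite expr_div_n d2; field; apply: lt0r_neq0; nra.
have e1 : Defs.edist (bipolar p q) F1 = d / 2 * (1 + q).
  apply/edist_eq; first by rewrite mulr_ge0; lra.
  rewrite opprK subr0 bipolar_focal // d4; ring.
have e2 : Defs.edist (bipolar p q) F2 = d / 2 * (1 - q).
  apply/edist_eq; first by rewrite mulr_ge0; lra.
  rewrite subr0 bipolar_focal // d4 /=; ring.
by rewrite /ellipse /= e1 e2; field.
Qed.

(** * The images of the three families of lines *)

Lemma arc_elliptic (R : realType) (c : R) : 0 < c ->
  exists2 K : circle R, elliptic_pencil K &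
    arc_of (circle_set K) (@phi R @` (Omega `&` [set p | p.1 = c])).
Proof.
move=> c0.
have [p p0 cp] := gt0_lnP _ _ c0.
pose k := (1 - p ^+ 2) / (2 * p).
have r0 : 0 < Num.sqrt (1 + k ^+ 2) by rewrite sqrtr_gt0; nra.
pose K := Circle (0, k) r0.
have EK : elliptic_pencil K.
  by apply/elliptic_pencilE; split=> //=; rewrite sqr_sqrtr //; nra.
exists K => //.
have -> : Omega `&` [set z : R * R | z.1 = c] =
    (fun y => (c, y)) @` [set y | y < 0].
  apply/seteqP; split=> [[x y] [[/= x0 y0] ->]|_ [y y0 <-]]; first by exists y.
  by split.
apply: arc_of_phi_path.
- by move=> /= x y x0 y0 z /andP[xz zy]; lra.
- by move=> y; exact: cvg_pair (cvg_cst c) (@cvg_id _ (nbhs y)).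
- by move=> y z [].
- by move=> _ [y y0 <-]; split.
- by exists (-1), (-2); split=> /=; [lra|lra|rewrite gt_eqF //; lra].
- move=> y y0.
  have [q q01 ->] := lt0_lnP _ _ y0; rewrite cp phi_bipolar //.
  apply: elliptic_circle_mem => //; first by case/andP: q01.
  by rewrite /= /k; field; rewrite lt0r_neq0.
(* The foci lie on the boundary of the quadrant. *)
- by exists F1; [case: EK|case=> /=; lra].
Qed.

Lemma arc_hyperbolic (R : realType) (c : R) : c < 0 ->
  exists2 K : circle R, hyperbolic_pencil K &
    arc_of (circle_set K) (@phi R @` (Omega `&` [set p | p.2 = c])).
Proof.
move=> c0.
have [q q01 cq] := lt0_lnP _ _ c0; have /andP[q0 q1] := q01.
pose h := (1 + q ^+ 2) / (2 * q).
have h0 : 0 < h by apply: divr_gt0; nra.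
have r0 : 0 < (1 - q ^+ 2) / (2 * q) by apply: divr_gt0; nra.
pose K := Circle (h, 0) r0.
have rh : Defs.radius K ^+ 2 = (Defs.center K).1 ^+ 2 - 1.
  by rewrite /= /h; field; rewrite lt0r_neq0.
exists K; first exact: hyperbolic_pencil_suff.
have -> : Omega `&` [set z : R * R | z.2 = c] =
    (fun x => (x, c)) @` [set x | 0 < x].
  apply/seteqP; split=> [[x y] [[/= x0 y0] ->]|_ [y y0 <-]]; first by exists x.
  by split.
apply: arc_of_phi_path.
- by move=> /= x y x0 y0 z /andP[xz zy]; lra.
- by move=> y; exact: cvg_pair (@cvg_id _ (nbhs y)) (cvg_cst c).
- by move=> y z [].
- by move=> _ [y y0 <-]; split.
- by exists 2, 1; split=> /=; [lra|lra|rewrite gt_eqF //; lra].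
- move=> x x0.
  have [p p0 ->] := gt0_lnP _ _ x0; rewrite cq phi_bipolar //.
  apply: hyperbolic_circle_mem => //.
  by rewrite /= /h; field; rewrite lt0r_neq0.
(* A point of the circle on the axis. *)
- exists (h + Defs.radius K, 0); last by case=> /=; lra.
  by apply/circle_setE => /=; ring.
Qed.

(** The constant is [d = 2 / sqrt (1 - e^(-c))], since
    [e^(-c) = (1 - q^2) / (1 + p^2)] along the line [x - y = c]. *)
Lemma arc_ellipse (R : realType) (c : R) : 0 < c ->
  exists2 d : R, 2 < d &
    arc_of (ellipse d) (@phi R @` (Omega `&` [set p | p.1 - p.2 = c])).
Proof.
move=> c0.
have e0 := expR_gt0 (- c).
have e1 : expR (- c) < 1 by rewrite expR_lt1; lra.
pose m := Num.sqrt (1 - expR (- c)).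
have m0 : 0 < m by rewrite sqrtr_gt0; lra.
have m2 : m ^+ 2 = 1 - expR (- c) by rewrite sqr_sqrtr //; lra.
have d2 : 2 < 2 / m by rewrite ltr_pdivlMr //; nra.
exists (2 / m) => //; set d := 2 / m in d2 *.
have -> : Omega `&` [set z : R * R | z.1 - z.2 = c] =
    (fun x => (x, x - c)) @` [set x | 0 < x < c].
  apply/seteqP; split=> [[x y] [[/= x0 y0] xy]|_ [x /andP[x0 xc] <-]].
    by exists x => /=; [lra|congr pair; lra].
  by split=> /=; [split=> /=|]; lra.
apply: arc_of_phi_path.
- by move=> /= x y x0 y0 z /andP[xz zy]; lra.
- move=> y; have y_id : x @[x --> y] --> y by exact: cvg_id.
  exact: cvg_pair y_id (cvgB y_id (cvg_cst c)).
- by move=> y z [].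
- by move=> _ [y /andP[y0 yc] <-]; split=> /=; lra.
- by exists (c / 2), (c / 3); split=> /=; [lra|lra|rewrite gt_eqF //; lra].
- move=> x /andP[x0 xc].
  have /OmegaP[p [q [p0 q01 xy]]] : Omega (x, x - c) by split=> /=; lra.
  rewrite xy phi_bipolar //; case: xy => xp yq; have /andP[q0 q1] := q01.
  apply: ellipse_bipolar => //; first lra.
  have -> : d ^+ 2 = 4 / m ^+ 2 by rewrite /d; field; rewrite lt0r_neq0.
  have a0 : 0 < 1 + p ^+ 2 by nra.
  have -> : m ^+ 2 = (p ^+ 2 + q ^+ 2) / (1 + p ^+ 2).
    rewrite m2; have -> : - c = (x - c) - x by lra.
    by rewrite expRB yq xp !lnK ?posrE //; [field; rewrite lt0r_neq0|nra].
  by field; rewrite !lt0r_neq0 //; nra.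
(* A vertex of the ellipse on its major axis. *)
- exists (d / 2, 0); last by case=> /=; lra.
  have -> : d = (d / 2 + 1) + (d / 2 - 1) by lra.
  rewrite /ellipse /=; congr (_ + _); apply/edist_eq => /=; lra.
Qed.

Theorem theorem2 (R : realType) :
  [/\ set_fun Omega quadrant1 (@phi R) /\ set_surj Omega quadrant1 (@phi R),
      (forall c : R, 0 < c ->
         exists2 K : circle R, elliptic_pencil K &
           arc_of (circle_set K) (@phi R @` (Omega `&` [set p | p.1 = c]))),
      (forall c : R, c < 0 ->
         exists2 K : circle R, hyperbolic_pencil K &
           arc_of (circle_set K) (@phi R @` (Omega `&` [set p | p.2 = c])))
    & (forall c : R, 0 < c ->
         exists2 d : R, 2 < d &
           arc_of (ellipse d) (@phi R @` (Omega `&` [set p | p.1 - p.2 = c])))].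
Proof.
split; [|exact: arc_elliptic|exact: arc_hyperbolic|exact: arc_ellipse].
split; first exact: phi_quadrant1.
move=> [s t] [/= s0 t0]; have [p [q [p0 q01 <-]]] := bipolar_surj _ _ _ s0 t0.
exists (ln (1 + p ^+ 2), ln (1 - q ^+ 2)); last exact: phi_bipolar.
by apply/OmegaP; exists p, q.
Qed.
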